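(* Let $N\in\mathbb{N}$, $\gamma_1,\dots,\gamma_N\ge 0$, and let $\Phi_1,\dots,\Phi_N$ be independent random variables where $\Phi_i$ has the law of $Y_i\bmod 2\pi$ with $Y_i\sim\mathcal{N}(0,\gamma_i)$. For $\mathcal{S}\subseteq[N]:=\{1,\dots,N\}$ let $\overline{G}(\mathcal{S}):=\sum_{i\in\mathcal{S}}\sum_{j\in\mathcal{S}}\cos(\Phi_i-\Phi_j)$. Then both set functions $\mathcal{S}\mapsto\mathbb{E}[\overline{G}(\mathcal{S})]$ and $\mathcal{S}\mapsto\mathrm{Var}(\overline{G}(\mathcal{S}))$ on $2^{[N]}$ are supermodular.
   Context: A set function $f:2^{\Omega}\to\mathbb{R}$ is submodular if for all $X\subseteq Y\subseteq\Omega$ and every $e\in\Omega\setminus Y$, $f(X\cup\{e\})-f(X)\ge f(Y\cup\{e\})-f(Y)$; $f$ is supermodular if $-f$ is submodular. $\overline{G}(\mathcal{S})$ is the beamforming gain of the subset $\mathcal{S}$ of agents, $\gamma_i$ the effective localization error and $\Phi_i$ the wrapped normal total phase of agent $i$. *)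

(* Defs.v *)
From HB Require Import structures.
From mathcomp Require Import all_boot all_order all_algebra.
From mathcomp Require Import all_classical all_reals all_analysis.
Set Implicit Arguments. Unset Strict Implicit. Unset Printing Implicit Defensive.
Import Order.TTheory GRing.Theory Num.Theory.
Local Open Scope classical_set_scope.
Local Open Scope ring_scope.

(* Submodular / supermodular set functions on the ground set 'I_N (= [N]),
   with values in the extended reals (the values considered are finite). *)
Definition submodular (R : realType) (N : nat) (f : {set 'I_N} -> \bar R) :=
  forall (X Y : {set 'I_N}) (e : 'I_N), X \subset Y -> e \notin Y ->
    (f (e |: Y) - f Y <= f (e |: X) - f X)%E.

Definition supermodular (R : realType) (N : nat) (f : {set 'I_N} -> \bar R) :=
  submodular (fun S => - f S)%E.

Definition wrap2pi (R : realType) (y : R) : R :=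
  y - (2 * pi) * (Num.floor (y / (2 * pi)))%:~R.

Definition gauss_law (R : realType) (g : R) : set R -> \bar R :=
  if g == 0 then (fun B => \d_(0 : R) B)
  else normal_prob 0 (Num.sqrt g).

Definition has_wrapped_normal_law d (T : measurableType d) (R : realType)
    (P : probability T R) (X : T -> R) (g : R) :=
  forall A : set R, measurable A ->
    P (X @^-1` A) = gauss_law g (@wrap2pi R @^-1` A).

Definition mutually_independent d (T : measurableType d) (R : realType)
    (P : probability T R) (N : nat) (X : 'I_N -> T -> R) :=
  forall (J : {set 'I_N}) (A : 'I_N -> set R), (forall i, measurable (A i)) ->
    P [set t | forall i, i \in J -> A i (X i t)] =
    (\prod_(i in J) P (X i @^-1` A i))%E.

Definition beam_gain (T : Type) (R : realType) (N : nat)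
    (Phi : 'I_N -> T -> R) (S : {set 'I_N}) : T -> R :=
  fun t => \sum_(i in S) \sum_(j in S) cos (Phi i t - Phi j t).

(* Main.v *)
(** Write c_ij := cos (Phi_i - Phi_j). Both set functions are sums, over tuples of
    agents contained in S, of weights not depending on S, and such a sum is
    supermodular as soon as the weights are nonnegative. For the expectation the
    weights are the E[c_ij], for the variance the Cov(c_ij, c_kl).

    Put a_i := E[cos Phi_i]. Since E[sin Phi_i] = 0, independence gives
    E[c_ij] = a_i a_j for i <> j; the covariance vanishes when {i,j} and {k,l} are
    disjoint, is a variance when they are equal, and is
    a_j a_l Var(cos Phi_i) when they share exactly the index i.

    So only a_i >= 0 is needed about the Gaussian law. If Y, Y' are independent
    centered normal variables of variance v/2, then Y + Y' is normal of variance v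
    and E[cos (Y + Y')] = E[cos Y]^2 - E[sin Y]^2 = E[cos Y]^2 >= 0. *)
Require Import Defs.
From HB Require Import structures.
From mathcomp Require Import all_boot all_order all_algebra.
From mathcomp Require Import all_classical all_reals all_analysis.
From mathcomp Require Import measurable_realfun ring lra.
Import Order.TTheory GRing.Theory Num.Theory.
Import numFieldNormedType.Exports HBNNSimple.
Local Open Scope classical_set_scope.
Local Open Scope ring_scope.

Set Implicit Arguments. Unset Strict Implicit. Unset Printing Implicit Defensive.

(** * Integration against an image of a density *)

Section image_density.
Local Open Scope ereal_scope.
Context d d' (T : measurableType d) (U : measurableType d') (R : realType).
Variables (m : {measure set T -> \bar R}) (nu : {measure set U -> \bar R}).
Variables (X : T -> U) (z : T -> R).
Hypotheses (mX : measurable_fun setT X) (mz : measurable_fun setT z).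
Hypothesis z_ge0 : forall t, (0 <= z t)%R.
Hypothesis nuE : forall A, measurable A ->
  nu A = \int[m]_(t in X @^-1` A) (z t)%:E.

(** A simple function is a finite combination of indicators of its fibres, and [nuE] evaluates [nu]
    on each fibre. *)
Lemma integral_nnsfun_image_density (h : {nnsfun U >-> R}) :
  \int[nu]_u (h u)%:E = \int[m]_t (h (X t) * z t)%:E.
Proof.
have hE t : (h (X t) * z t)%:E =
    \sum_(r \in range h) (r * (\1_(X @^-1` (h @^-1` [set r])) t * z t))%:E.
  rewrite fsumEFin// fimfunE mulr_fsuml.
  by congr _%:E; apply: eq_fsbigr => r _; rewrite mulrA.
have mXr r : measurable (X @^-1` (h @^-1` [set r])).
  by rewrite -[X in measurable X]setTI; exact: mX.
have mzr r : measurable_fun [set: T]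
    (fun t => \1_(X @^-1` (h @^-1` [set r])) t * z t)%R.
  by apply: measurable_funM => //; exact: measurable_indic.
rewrite integralT_nnsfun sintegralE (eq_integral _ _ (fun t _ => hE t)).
rewrite ge0_integral_fsum//; last 2 first.
- by move=> r; apply/measurable_EFinP/measurable_funM.
- move=> r t _; rewrite lee_fin mulrA mulr_ge0//.
  by have := nnfun_muleindic_ge0 h r (X t); rewrite lee_fin.
apply: eq_fsbigr => r; rewrite inE => -[u _ hu].
under eq_integral do rewrite EFinM.
rewrite ge0_integralZl//; last 3 first.
- exact/measurable_EFinP.
- by move=> t _; rewrite lee_fin mulr_ge0.
- by rewrite lee_fin -hu.
congr (_ * _); rewrite nuE// integral_mkcond; apply: eq_integral => t _.
rewrite patchE indicE; case: ifPn => _; by rewrite ?mul1r ?mul0r.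
Qed.

(** Monotone convergence on both sides, along simple functions increasing to [f]. Three uses follow:
    [z] a random variable, for independence; [X] the identity and [z] a normal density; [z]
    constantly 1, for a change of law. *)
Lemma ge0_integral_image_density (f : U -> R) :
  measurable_fun setT f -> (forall u, (0 <= f u)%R) ->
  \int[nu]_u (f u)%:E = \int[m]_t (f (X t) * z t)%:E.
Proof.
move=> mf f_ge0.
have mEf : measurable_fun setT (EFin \o f) by exact/measurable_EFinP.
pose h := nnsfun_approx measurableT mEf.
have h_cvg u : (h n u)%:E @[n --> \oo] --> (f u)%:E.
  by apply: (cvg_nnsfun_approx measurableT mEf) => // v _; rewrite lee_fin.
have h_nd u : {homo (fun n => h n u) : k l / (k <= l)%N >-> (k <= l)%R}.
  by move=> k l kl; exact/lefP/nd_nnsfun_approx.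
have L : \int[nu]_u (h n u)%:E @[n --> \oo] --> \int[nu]_u (f u)%:E.
  rewrite [X in _ --> X](_ : _ = \int[nu]_u limn (fun n => (h n u)%:E)).
    apply: cvg_monotone_convergence => //.
    - by move=> n; exact/measurable_EFinP.
    - by move=> n u _; rewrite lee_fin.
    - by move=> u _ k l kl; rewrite lee_fin h_nd.
  by apply: eq_integral => u _; apply/esym/cvg_lim.
have Rr : \int[m]_t (h n (X t) * z t)%:E @[n --> \oo] -->
    \int[m]_t (f (X t) * z t)%:E.
  rewrite [X in _ --> X](_ : _ =
      \int[m]_t limn (fun n => (h n (X t) * z t)%:E)).
    apply: cvg_monotone_convergence => //.
    - move=> n; apply/measurable_EFinP/measurable_funM => //.
      exact: measurableT_comp.
    - by move=> n t _; rewrite lee_fin mulr_ge0.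
    - by move=> t _ k l kl; rewrite lee_fin ler_wpM2r// h_nd.
  apply: eq_integral => t _; apply/esym/cvg_lim => //.
  under eq_fun do rewrite EFinM; rewrite EFinM.
  by apply: cvgeZr.
rewrite -(cvg_lim _ L)// -(cvg_lim _ Rr)//.
by congr (limn _); apply/funext => n; exact: integral_nnsfun_image_density.
Qed.

End image_density.

(** * Bounded random variables and independence *)

(** This class contains the sines and cosines, is stable under sums and products, and is integrable
    for every probability, so one hypothesis settles all integrability conditions below. *)
Definition bounded_measurable d (T : measurableType d) (R : realType)
    (f : T -> R) :=
  measurable_fun setT f /\ exists M : R, forall t, `|f t| <= M.

Section bounded_measurable.
Context d (T : measurableType d) (R : realType).
Implicit Types f g : T -> R.

Lemma bounded_measurable_cst (c : R) : bounded_measurable (fun _ : T => c).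
Proof. by split=> //; exists `|c|. Qed.

Lemma bounded_measurableD {f g} : bounded_measurable f -> bounded_measurable g ->
  bounded_measurable (fun t => f t + g t).
Proof.
move=> [mf [M fM]] [mg [K gK]]; split; first exact: measurable_funD.
by exists (M + K) => t; rewrite (le_trans (ler_normD _ _))// lerD.
Qed.

Lemma bounded_measurableM {f g} : bounded_measurable f -> bounded_measurable g ->
  bounded_measurable (fun t => f t * g t).
Proof.
move=> [mf [M fM]] [mg [K gK]]; split; first exact: measurable_funM.
by exists (M * K) => t; rewrite normrM ler_pM.
Qed.

Lemma bounded_measurableB {f g} : bounded_measurable f -> bounded_measurable g ->
  bounded_measurable (fun t => f t - g t).
Proof.
move=> bf [mg [K gK]]; apply: bounded_measurableD => //.
by split; [exact: measurableT_comp|exists K => t; rewrite normrN].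
Qed.

Lemma bounded_measurable_sum I (r : seq I) (p : pred I) (F : I -> T -> R) :
  (forall i, bounded_measurable (F i)) ->
  bounded_measurable (fun t => \sum_(i <- r | p i) F i t).
Proof.
move=> bF; elim: r => [|i r IHr].
  by under eq_fun do rewrite big_nil; exact: bounded_measurable_cst.
under eq_fun do rewrite big_cons.
by case: (p i) => //; exact: bounded_measurableD.
Qed.

Lemma bounded_measurable_prod I (r : seq I) (F : I -> T -> R) :
  (forall i, bounded_measurable (F i)) ->
  bounded_measurable (fun t => \prod_(i <- r) F i t).
Proof.
move=> bF; elim: r => [|i r IHr].
  by under eq_fun do rewrite big_nil; exact: bounded_measurable_cst.
by under eq_fun do rewrite big_cons; exact: bounded_measurableM.
Qed.

Lemma bounded_measurable_comp d' (U : measurableType d') (X : T -> U)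
    (f : U -> R) : measurable_fun setT X -> bounded_measurable f ->
  bounded_measurable (fun t => f (X t)).
Proof.
move=> mX [mf [M fM]]; split; first exact: measurableT_comp.
by exists M => t.
Qed.

Lemma bounded_measurable_indic (A : set T) : measurable A ->
  bounded_measurable (\1_A : T -> R).
Proof.
move=> mA; split; first exact: measurable_indic.
by exists 1 => t; rewrite indicE; case: (_ \in _); rewrite ?normr1 ?normr0.
Qed.

(** Adding a constant reduces identities between expectations of bounded functions to nonnegative
    integrands. *)
Lemma bounded_measurable_shift_ge0 {f} : bounded_measurable f ->
  exists M : R, 0 <= M /\ forall t, 0 <= f t + M.
Proof.
move=> [_ [M fM]]; exists `|M|; split=> // t.
by have /ler_normlP[] := fM t; have := ler_norm M; lra.
Qed.

End bounded_measurable.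

Section bounded_expectation.
Context d (T : measurableType d) (R : realType) (P : probability T R).
Implicit Types f g : T -> R.
Local Notation E f := (\int[P]_t f t)%R.

Lemma bounded_measurable_integrable {f} : bounded_measurable f ->
  P.-integrable setT (EFin \o f).
Proof.
move=> [mf [M fM]]; apply: measurable_bounded_integrable => //.
  exact/fin_num_fun_lty/fin_num_measure.
exists M; split; first by rewrite num_real.
by move=> x Mx t _; exact: le_trans (fM t) (ltW Mx).
Qed.

Lemma EFin_Rintegral {f} : bounded_measurable f ->
  (E f)%:E = (\int[P]_t (f t)%:E)%E.
Proof.
move=> bf; rewrite fineK//.
by apply: integrable_fin_num => //; exact: bounded_measurable_integrable.
Qed.

Lemma bounded_RintegralD {f g} : bounded_measurable f -> bounded_measurable g ->
  E (fun t => f t + g t) = E f + E g.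
Proof.
move=> bf bg.
by rewrite RintegralD//; exact: bounded_measurable_integrable.
Qed.

Lemma bounded_RintegralB {f g} : bounded_measurable f -> bounded_measurable g ->
  E (fun t => f t - g t) = E f - E g.
Proof.
move=> bf bg.
by rewrite RintegralB//; exact: bounded_measurable_integrable.
Qed.

Lemma bounded_RintegralZl (c : R) {f} : bounded_measurable f ->
  E (fun t => c * f t) = c * E f.
Proof. by move=> /bounded_measurable_integrable ?; rewrite RintegralZl. Qed.

Lemma prob_Rintegral_cst (c : R) : E (fun _ => c) = c.
Proof. by rewrite Rintegral_cst//= probability_setT mulr1. Qed.

Lemma bounded_Rintegral_sum I (r : seq I) (p : pred I) (F : I -> T -> R) :
  (forall i, bounded_measurable (F i)) ->
  E (fun t => \sum_(i <- r | p i) F i t) = \sum_(i <- r | p i) E (F i).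
Proof.
move=> bF; elim: r => [|i r IHr].
  by under eq_Rintegral do rewrite big_nil; rewrite prob_Rintegral_cst big_nil.
under eq_Rintegral do rewrite big_cons; rewrite big_cons -IHr.
case: (p i) => //.
by rewrite bounded_RintegralD//; exact: bounded_measurable_sum.
Qed.

Lemma Rintegral_indic (A : set T) : measurable A -> (E (\1_A))%:E = P A.
Proof.
move=> mA; rewrite EFin_Rintegral; last exact: bounded_measurable_indic.
by rewrite integral_indic// setIT.
Qed.

End bounded_expectation.

(** * Independence: from events to products of bounded functions *)

Section independent_products.
Context d (T : measurableType d) (R : realType) (P : probability T R).
Local Notation E f := (\int[P]_t f t)%R.

Section one_variable.
Context d' (U : measurableType d') (X : T -> U).
Hypothesis mX : measurable_fun setT X.

(** By hypothesis, [c] times the law of [X] is the image under [X] of the measure with density [Z].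
    Integrating [f] against this measure in both descriptions gives the two sides. *)
Let ge0_Rintegral_mul_comp (Z : T -> R) (c : R) (f : U -> R) :
  bounded_measurable Z -> (forall t, 0 <= Z t) -> 0 <= c ->
  (forall A, measurable A ->
    E (fun t => Z t * \1_A (X t)) = c * E (fun t => \1_A (X t))) ->
  bounded_measurable f -> (forall u, 0 <= f u) ->
  E (fun t => Z t * f (X t)) = c * E (fun t => f (X t)).
Proof.
move=> bZ Z0 c0 ZA bf f0.
have bfX := bounded_measurable_comp mX bf.
apply: EFin_inj; rewrite EFinM !EFin_Rintegral//; last exact: bounded_measurableM.
pose cn := NngNum c0.
pose X' : {mfun T >-> U} := HB.pack X (isMeasurableFun.Build _ _ _ _ _ mX).
pose nu := mscale cn (distribution P X').
have bA A : measurable A -> bounded_measurable (fun t => \1_A (X t) : R).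
  move=> mA; apply: bounded_measurable_comp => //.
  exact: bounded_measurable_indic.
have nuE A : measurable A -> nu A = (\int[P]_(t in X @^-1` A) (Z t)%:E)%E.
  move=> mA; rewrite integral_mkcond.
  transitivity (\int[P]_t (Z t * \1_A (X t))%:E)%E; last first.
    apply: eq_integral => t _; rewrite patchE indicE.
    rewrite [t \in _](_ : _ = (X t \in A)); last by apply/idP/idP; rewrite !inE.
    by case: (_ \in _); rewrite ?mulr1 ?mulr0.
  rewrite -EFin_Rintegral; last by apply: bounded_measurableM => //; exact: bA.
  rewrite ZA// /nu /mscale /= EFinM; congr (_ * _)%E.
  rewrite EFin_Rintegral; last exact: bA.
  rewrite /distribution /pushforward /= -[X @^-1` A]setIT -integral_indic//.
  by rewrite -[X in measurable X]setTI; exact: mX.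
have := ge0_integral_image_density mX bZ.1 Z0 nuE bf.1 f0.
have mEf : measurable_fun setT (EFin \o f) by apply/measurable_EFinP; exact: bf.1.
have Ef0 u : setT u -> (0 <= (f u)%:E)%E by rewrite lee_fin.
rewrite (ge0_integral_mscale _ _ _ mEf Ef0)//= ge0_integral_distribution//=.
move=> ->; apply: eq_integral => t _; by rewrite mulrC.
Qed.

(** Shifting [Z] by [M] and [f] by [K] makes both nonnegative. Taking [A] to be the whole space
    shows that [c] is the mean of [Z], so [c + M] is the mean of [Z + M]; the extra terms of the
    shifted identity then cancel. *)
Lemma Rintegral_mul_comp (Z : T -> R) (c : R) (f : U -> R) :
  bounded_measurable Z ->
  (forall A, measurable A ->
    E (fun t => Z t * \1_A (X t)) = c * E (fun t => \1_A (X t))) ->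
  bounded_measurable f ->
  E (fun t => Z t * f (X t)) = c * E (fun t => f (X t)).
Proof.
move=> bZ ZA bf.
have [M [M0 ZM]] := bounded_measurable_shift_ge0 bZ.
have [K [K0 fK]] := bounded_measurable_shift_ge0 bf.
have bfX := bounded_measurable_comp mX bf.
have bcst (x : R) := bounded_measurable_cst T x.
have EZ : E Z = c.
  have := ZA setT measurableT.
  under eq_Rintegral do rewrite indicT mulr1.
  by under [in RHS]eq_Rintegral do rewrite indicT;
    rewrite prob_Rintegral_cst mulr1.
have cM : 0 <= c + M.
  have : 0 <= E (fun t => Z t + M) by exact: Rintegral_ge0.
  by rewrite bounded_RintegralD// prob_Rintegral_cst EZ.
have bA A : measurable A -> bounded_measurable (fun t => \1_A (X t) : R).
  move=> mA; apply: bounded_measurable_comp => //.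
  exact: bounded_measurable_indic.
have := @ge0_Rintegral_mul_comp (fun t => Z t + M) (c + M) (fun u => f u + K).
move/(_ (bounded_measurableD bZ (bcst M)) ZM cM).
have ZA' A : measurable A ->
    E (fun t => (Z t + M) * \1_A (X t)) = (c + M) * E (fun t => \1_A (X t)).
  move=> mA; under eq_Rintegral do rewrite mulrDl.
  rewrite bounded_RintegralD; last 2 first.
  - by apply: bounded_measurableM => //; exact: bA.
  - by apply: bounded_measurableM => //; exact: bA.
  by rewrite ZA// bounded_RintegralZl ?mulrDl//; exact: bA.
move/(_ ZA' (bounded_measurableD bf (bounded_measurable_cst U K)) fK).
rewrite bounded_RintegralD// prob_Rintegral_cst.
have -> : E (fun t => (Z t + M) * (f (X t) + K)) =
   E (fun t => Z t * f (X t)) + M * E (fun t => f (X t)) + K * c + M * K.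
  transitivity (E (fun t => Z t * f (X t) + M * f (X t) + K * Z t + M * K)).
    by apply: eq_Rintegral => t _; ring.
  have b1 := bounded_measurableM bZ bfX.
  have b2 := bounded_measurableM (bcst M) bfX.
  have b3 := bounded_measurableM (bcst K) bZ.
  have b12 := bounded_measurableD b1 b2.
  have b123 := bounded_measurableD b12 b3.
  by rewrite !bounded_RintegralD// !bounded_RintegralZl// prob_Rintegral_cst EZ.
by move=> H; nra.
Qed.

End one_variable.

End independent_products.

Section independent_family.
Context d (T : measurableType d) (R : realType) (P : probability T R).
Local Notation E f := (\int[P]_t f t)%R.
Context (N : nat) (X : 'I_N -> T -> R).
Hypothesis mX : forall i, measurable_fun setT (X i).
Hypothesis indX : mutually_independent P X.

Let cylinder (J : {set 'I_N}) (A : 'I_N -> set R) : set T :=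
  [set t | forall i, i \in J -> A i (X i t)].

Let measurable_preim i (B : set R) : measurable B -> measurable (X i @^-1` B).
Proof. by move=> mB; rewrite -[X in measurable X]setTI; exact: mX. Qed.

Let measurable_cylinder (J : {set 'I_N}) (A : 'I_N -> set R) :
  (forall i, measurable (A i)) ->
  measurable (cylinder J A).
Proof.
move=> mA; rewrite [cylinder J A](_ : _ =
  \bigcap_(i in [set i | i \in J]) (X i @^-1` A i))//.
apply: fin_bigcap_measurable => [|i _]; first exact: finite_finset.
exact: measurable_preim.
Qed.

Let Rintegral_cylinder (J : {set 'I_N}) (A : 'I_N -> set R) :
  (forall i, measurable (A i)) ->
  E (\1_(cylinder J A)) = \prod_(i in J) E (\1_(X i @^-1` A i)).
Proof.
move=> mA; apply: EFin_inj; rewrite Rintegral_indic; last exact: measurable_cylinder.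
rewrite indX// -prodEFin; apply: eq_bigr => i _.
by rewrite Rintegral_indic//; exact: measurable_preim.
Qed.

Let upd (A : 'I_N -> set R) (i : 'I_N) (B : set R) (j : 'I_N) :=
  if j == i then B else A j.

Let cylinder_upd (J : {set 'I_N}) A i B : i \notin J ->
  cylinder (i |: J) (upd A i B) = cylinder J A `&` X i @^-1` B.
Proof.
move=> iJ; rewrite /upd; apply/seteqP; split=> t /=.
- move=> H; split; last by have := H i; rewrite eqxx; apply; rewrite setU11.
  move=> j jJ; have := H j; rewrite ifN; last by apply: contraNneq iJ => <-.
  by apply; rewrite setU1r.
- move=> [H HB] j; rewrite in_setU1; case: eqVneq => [->//|_ /=]; exact: H.
Qed.

Let Rintegral_cylinder_upd (J : {set 'I_N}) (A : 'I_N -> set R) (i : 'I_N)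
    (B : set R) :
  (forall i, measurable (A i)) ->
  measurable B -> i \notin J ->
  E (\1_(cylinder (i |: J) (upd A i B))) =
  E (\1_(cylinder J A)) * E (fun t => \1_B (X i t)).
Proof.
move=> mA mB iJ.
have mU j : measurable (upd A i B j) by rewrite /upd; case: ifP.
rewrite !Rintegral_cylinder// big_setU1//= mulrC /upd eqxx; congr (_ * _).
apply: eq_bigr => j jJ; rewrite ifN//; by apply: contraNneq iJ => <-.
Qed.

(** Induction on [r], with the indicator of a cylinder carried along and [J], [A] left general.
    Splitting off the factor at [i] by [Rintegral_mul_comp] asks for the claim with the indicator of
    [B] in place of [f i]; this indicator merges into a cylinder over [i |: J], to which the
    induction hypothesis applies. *)
Let Rintegral_prod_cylinder (f : 'I_N -> R -> R) (r : seq 'I_N) :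
  (forall i, bounded_measurable (f i)) -> uniq r ->
  forall (J : {set 'I_N}) (A : 'I_N -> set R), (forall i, i \in r -> i \notin J) ->
  (forall i, measurable (A i)) ->
  E (fun t => (\prod_(i <- r) f i (X i t)) * \1_(cylinder J A) t) =
  (\prod_(i <- r) E (fun t => f i (X i t))) * E (\1_(cylinder J A)).
Proof.
move=> bf; elim: r => [_|i r IHr /= /andP[ir ur]] J A rJ mA.
  by rewrite big_nil mul1r; under eq_Rintegral do rewrite big_nil mul1r.
have bfX j := bounded_measurable_comp (mX j) (bf j).
pose Z t := (\prod_(j <- r) f j (X j t)) * \1_(cylinder J A) t.
transitivity (E (fun t => Z t * f i (X i t))).
  by apply: eq_Rintegral => t _; rewrite big_cons /Z; ring.
have rJ' j : j \in r -> j \notin J by move=> jr; apply: rJ; rewrite inE jr orbT.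
have iJ : i \notin J by apply: rJ; rewrite mem_head.
rewrite big_cons -mulrA [RHS]mulrC -IHr//.
apply: (Rintegral_mul_comp (mX i)) => //.
  apply: bounded_measurableM; first exact: bounded_measurable_prod.
  by apply: bounded_measurable_indic; exact: measurable_cylinder.
move=> B mB.
transitivity (E (fun t => (\prod_(j <- r) f j (X j t)) *
    \1_(cylinder (i |: J) (upd A i B)) t)).
  apply: eq_Rintegral => t _; rewrite cylinder_upd// indicI /Z /= mulrA.
  by rewrite !indicE.
rewrite IHr// ?Rintegral_cylinder_upd ?mulrA -?IHr//.
- move=> j jr; rewrite in_setU1 negb_or rJ'// andbT.
  by apply: contraNneq ir => <-.
- by move=> j; rewrite /upd; case: ifP.
Qed.

Lemma Rintegral_prod_independent (f : 'I_N -> R -> R) (r : seq 'I_N) :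
  (forall i, bounded_measurable (f i)) -> uniq r ->
  E (fun t => \prod_(i <- r) f i (X i t)) =
  \prod_(i <- r) E (fun t => f i (X i t)).
Proof.
move=> bf ur.
(* The cylinder over no index is the whole space, so its indicator disappears. *)
have c1 : cylinder finset.set0 (fun=> setT) = setT.
  by apply/seteqP; split=> // t _ i; rewrite inE.
have := @Rintegral_prod_cylinder f r bf ur finset.set0 (fun=> setT).
rewrite c1 indicT prob_Rintegral_cst mulr1 => <- //.
by under [in RHS]eq_Rintegral do rewrite /= mulr1.
by move=> i _; rewrite inE.
Qed.

Lemma Rintegral_mul2_independent (i j : 'I_N) (f g : R -> R) : i != j ->
  bounded_measurable f -> bounded_measurable g ->
  E (fun t => f (X i t) * g (X j t)) =
  E (fun t => f (X i t)) * E (fun t => g (X j t)).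
Proof.
move=> ij bf bg; pose F m := if m == i then f else g.
have bF m : bounded_measurable (F m) by rewrite /F; case: ifP.
have Fi : F i = f by rewrite /F eqxx.
have Fj : F j = g by rewrite /F eq_sym (negbTE ij).
have := @Rintegral_prod_independent F [:: i; j] bF.
rewrite /= inE ij !big_cons big_nil Fi Fj mulr1 => <- //.
by under [in RHS]eq_Rintegral do rewrite !big_cons big_nil Fi Fj mulr1.
Qed.

Lemma Rintegral_mul3_independent (i j k : 'I_N) (f g h : R -> R) :
  uniq [:: i; j; k] ->
  bounded_measurable f -> bounded_measurable g -> bounded_measurable h ->
  E (fun t => f (X i t) * g (X j t) * h (X k t)) =
  E (fun t => f (X i t)) * E (fun t => g (X j t)) * E (fun t => h (X k t)).
Proof.
move=> u bf bg bh; pose F m := if m == i then f else if m == j then g else h.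
have bF m : bounded_measurable (F m) by rewrite /F; do 2 case: ifP => // _.
have := u; rewrite /= !inE !negb_or andbT => /andP[/andP[ij ik] jk].
have Fi : F i = f by rewrite /F eqxx.
have Fj : F j = g by rewrite /F eq_sym (negbTE ij) eqxx.
have Fk : F k = h by rewrite /F ![k == _]eq_sym (negbTE ik) (negbTE jk).
have := Rintegral_prod_independent bF u.
rewrite !big_cons big_nil Fi Fj Fk mulr1 !mulrA => <-.
by under [in RHS]eq_Rintegral do rewrite !big_cons big_nil Fi Fj Fk mulr1 !mulrA.
Qed.

Lemma Rintegral_mul4_independent (i j k l : 'I_N) (f g h e : R -> R) :
  uniq [:: i; j; k; l] ->
  bounded_measurable f -> bounded_measurable g -> bounded_measurable h ->
  bounded_measurable e ->
  E (fun t => f (X i t) * g (X j t) * h (X k t) * e (X l t)) =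
  E (fun t => f (X i t)) * E (fun t => g (X j t)) * E (fun t => h (X k t)) *
  E (fun t => e (X l t)).
Proof.
move=> u bf bg bh be.
pose F m := if m == i then f else if m == j then g else if m == k then h else e.
have bF m : bounded_measurable (F m) by rewrite /F; do 3 case: ifP => // _.
have := u; rewrite /= !inE !negb_or andbT.
move=> /and3P[/and3P[ij ik il] /andP[jk jl] kl].
have Fi : F i = f by rewrite /F eqxx.
have Fj : F j = g by rewrite /F eq_sym (negbTE ij) eqxx.
have Fk : F k = h by rewrite /F ![k == _]eq_sym (negbTE ik) (negbTE jk) eqxx.
have Fl : F l = e.
  by rewrite /F ![l == _]eq_sym (negbTE il) (negbTE jl) (negbTE kl).
have := Rintegral_prod_independent bF u.
rewrite !big_cons big_nil Fi Fj Fk Fl mulr1 !mulrA => <-.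
by under [in RHS]eq_Rintegral do
  rewrite !big_cons big_nil Fi Fj Fk Fl mulr1 !mulrA.
Qed.

End independent_family.

(** * Trigonometric moments of normal and wrapped normal laws *)

Section integral_reflection_translation.
Context (R : realType).
Local Notation mu := (@lebesgue_measure R).
Local Open Scope ereal_scope.

(** Folding the line at 0 gives an expression that is symmetric in [G] and its reflection, whence
    [ge0_integralT_oppr]. *)
Let ge0_integralT_fold (G : R -> R) : continuous G -> (forall x, (0 <= G x)%R) ->
  \int[mu]_x (G x)%:E =
  \int[mu]_(x in `[0%R, +oo[) (G x)%:E + \int[mu]_(x in `[0%R, +oo[) (G (- x))%:E.
Proof.
move=> cG G0.
have mG : measurable_fun [set: R] G by exact: continuous_measurable_fun.
rewrite -(setUv (`[0%R, +oo[%classic : set R)) ge0_integral_setU//= ; last 4 first.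
- exact: measurableC.
- by apply/measurable_EFinP; rewrite setUv.
- by move=> x _; rewrite lee_fin.
- exact/disj_setPCl.
congr +%E; rewrite setCitvr.
rewrite integral_itv_bndo_bndc; last exact/measurable_EFinP/measurable_funTS.
rewrite -{1}oppr0 ge0_integration_by_substitutionNy//.
exact: continuous_subspaceT.
Qed.

Lemma ge0_integralT_oppr (G : R -> R) : continuous G -> (forall x, (0 <= G x)%R) ->
  \int[mu]_x (G x)%:E = \int[mu]_x (G (- x))%:E.
Proof.
move=> cG G0; rewrite ge0_integralT_fold// [RHS]ge0_integralT_fold//.
  by rewrite addeC; under [X in _ = _ + X]eq_integral do rewrite opprK.
by move=> x; apply: (continuous_comp (@oppr_continuous _ R x)); exact: cG.
Qed.

Lemma ge0_integralT_shift (c : R) (G : R -> R) :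
  continuous G -> (forall x, (0 <= G x)%R) ->
  \int[mu]_x (G x)%:E = \int[mu]_x (G (x + c))%:E.
Proof.
move=> cG G0.
have dF (x : R) : is_derive x 1%R (fun y : R => y + c)%R 1%R.
  by rewrite -[X in is_derive _ _ _ X]addr0; apply: is_deriveD.
have F' : (fun y : R => y + c)%R^`()%classic = cst 1%R.
  by apply/funext => x; rewrite derive1E; apply: derive_val.
rewrite (@increasing_ge0_integration_by_substitutionT _ (fun y => y + c)%R)//.
- by apply: eq_integral => x _; rewrite F' /= mulr1.
- by move=> x y xy; rewrite ltrD2r.
- by rewrite F' => x; exact: cvg_cst.
- by rewrite F'; exact: is_cvg_cst.
- by rewrite F'; exact: is_cvg_cst.
- exact: cvg_addrr_Ny.
- exact: cvg_addrr.
Qed.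

End integral_reflection_translation.

Section normal_trigonometric_moments.
Context (R : realType).
Local Notation mu := (@lebesgue_measure R).

(* [normal_prob] lives on this measurable structure on [R], which has the same
   measurable sets as the canonical one. *)
Local Notation Rm := (measurableTypeR R).

Lemma bounded_measurable_cos : @bounded_measurable _ R R cos.
Proof.
split; first exact: continuous_measurable_fun (@continuous_cos R).
by exists 1 => t; exact: cos_max.
Qed.

Lemma bounded_measurable_sin : @bounded_measurable _ R R sin.
Proof.
split; first exact: continuous_measurable_fun (@continuous_sin R).
by exists 1 => t; exact: sin_max.
Qed.

Let bcos : @bounded_measurable _ Rm R cos.
Proof. exact: bounded_measurable_cos. Qed.

Let bsin : @bounded_measurable _ Rm R sin.
Proof. exact: bounded_measurable_sin. Qed.

Let bcst (c : R) : @bounded_measurable _ Rm R (fun=> c).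
Proof. exact: bounded_measurable_cst. Qed.

Lemma EFin_Rintegral_normal_prob (s : R) (f : R -> R) :
  @bounded_measurable _ Rm R f -> (forall x, 0 <= f x) ->
  ((\int[normal_prob 0 s]_x f x)%:E = \int[mu]_x (f x * normal_pdf 0 s x)%:E)%E.
Proof.
move=> bf f0; rewrite EFin_Rintegral//.
by apply: (@ge0_integral_image_density _ _ _ _ _ mu _ id) => //;
  [exact: measurable_normal_pdf|exact: normal_pdf_ge0|exact: bf.1].
Qed.

Lemma normal_pdf_opp (s x : R) : s != 0 -> normal_pdf 0 s (- x) = normal_pdf 0 s x.
Proof. by move=> s0; rewrite !normal_pdfE// /normal_fun !subr0 sqrrN. Qed.

(* The density of a sum of two independent centered normal variables of variance
   [r ^+ 2], with the square completed in [x]. *)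
Lemma normal_pdf_mul_shift (r s x u : R) : 0 < r -> 0 < s ->
  s ^+ 2 = r ^+ 2 *+ 2 ->
  normal_pdf 0 r (u - x) * normal_pdf 0 r x =
  normal_pdf 0 s u * normal_pdf (u / 2) (s / 2) x.
Proof.
move=> r0 s0 sr.
have h2 : (s / 2) ^+ 2 = r ^+ 2 / 2 by rewrite expr_div_n sr; field.
rewrite !normal_pdfE; [|by rewrite gt_eqF ?divr_gt0..].
rewrite mulrACA [RHS]mulrACA; congr (_ * _).
  have ph (c : R) : 0 <= c -> 0 <= c * pi *+ 2.
    by move=> c0; rewrite mulrn_wge0// mulr_ge0// pi_ge0.
  have r2 : 0 <= r ^+ 2 by exact: sqr_ge0.
  rewrite /normal_peak h2 sr -!invfM -!sqrtrM ?ph ?divr_ge0 ?mulrn_wge0//.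
  by congr (Num.sqrt _)^-1; field.
rewrite /normal_fun h2 sr -!expRD; congr expR; field.
by rewrite gt_eqF.
Qed.

Section moments.
Variables (s : R) (s_gt0 : 0 < s).
Local Notation E f := (\int[normal_prob 0 s]_t f t)%R.

(** The density is even and the sine odd, so reflection exchanges [1 + sin x] and [1 - sin x]; the
    constant 1 keeps the integrands nonnegative. *)
Lemma normal_sin_moment : E (@sin R) = 0.
Proof.
have bs := bsin.
have b1 := bcst 1.
have bD := bounded_measurableD b1 bs.
have bB := bounded_measurableB b1 bs.
have sD x : 0 <= 1 + sin x :> R by have := sin_geN1 x; lra.
have sB x : 0 <= 1 - sin x :> R by have := sin_le1 x; lra.
have s0 : s != 0 by rewrite gt_eqF.
suff : E (fun x => 1 + sin x) = E (fun x => 1 - sin x).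
  by rewrite bounded_RintegralD// bounded_RintegralB//; lra.
apply: EFin_inj; rewrite (EFin_Rintegral_normal_prob _ bD sD).
rewrite (EFin_Rintegral_normal_prob _ bB sB).
rewrite ge0_integralT_oppr.
- by apply: eq_integral => x _; rewrite sinN normal_pdf_opp.
- move=> x; apply: cvgM; last exact: continuous_normal_pdf.
  by apply: cvgD; [exact: cvg_cst|exact: continuous_sin].
- by move=> x; rewrite mulr_ge0// normal_pdf_ge0.
Qed.

End moments.

(** The mean of [1 + cos] at a sum of two independent normal variables is computed twice: through
    the law of the sum, and by averaging over one summand first. The constant 1 again makes the
    integrand nonnegative, as Tonelli requires. *)
Lemma normal_cos_moment_sqr (r s : R) : 0 < r -> 0 < s -> s ^+ 2 = r ^+ 2 *+ 2 ->
  \int[normal_prob 0 s]_t cos t = (\int[normal_prob 0 r]_t cos t) ^+ 2.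
Proof.
move=> r0 s0 sr.
have bc := bcos; have bs := bsin.
have b1 := bcst 1.
have bD := bounded_measurableD b1 bc.
have [a aE] : exists a, a = \int[normal_prob 0 r]_t cos t by eexists.
rewrite -aE.
have c0 x : 0 <= 1 + cos x :> R by have := cos_geN1 x; lra.
have p0 m t x : 0 <= normal_pdf m t x :> R by exact: normal_pdf_ge0.
have mp m t : measurable_fun setT (@normal_pdf R m t) by exact: measurable_normal_pdf.
have cc : continuous (fun x : R => 1 + cos x).
  by move=> x; apply: cvgD; [exact: cvg_cst|exact: continuous_cos].
(* Average over the second summand: in the addition formula the sine moment vanishes. *)
have shift x : 1 + a * cos x =
    \int[normal_prob 0 r]_y (1 + cos (x + y)).
  transitivity (\int[normal_prob 0 r]_y (1 + (cos x * cos y - sin x * sin y))).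
    have bx1 := bounded_measurableM (bcst (cos x)) bc.
    have bx2 := bounded_measurableM (bcst (sin x)) bs.
    rewrite bounded_RintegralD//; last exact: bounded_measurableB.
    rewrite bounded_RintegralB// !bounded_RintegralZl// normal_sin_moment//.
    by rewrite prob_Rintegral_cst -aE; ring.
  by apply: eq_Rintegral => y _; rewrite cosD.
have bac := bounded_measurableM (bcst a) bc.
have bD' := bounded_measurableD b1 bac.
have bsh x : @bounded_measurable _ Rm R (fun y => 1 + cos (x + y)).
  apply: (bounded_measurable_comp _ bD).
  exact: measurable_funD.
suff : \int[normal_prob 0 s]_u (1 + cos u) =
    \int[normal_prob 0 r]_x (1 + a * cos x).
  have ED1 (Q : probability Rm R) :
      \int[Q]_u (1 + cos u) = 1 + \int[Q]_u cos u.
    by rewrite bounded_RintegralD ?prob_Rintegral_cst.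
  have EDa (Q : probability Rm R) :
      \int[Q]_u (1 + a * cos u) = 1 + a * \int[Q]_u cos u.
    by rewrite bounded_RintegralD ?bounded_RintegralZl ?prob_Rintegral_cst.
  rewrite (ED1 (normal_prob 0 s)). rewrite EDa -aE.
  by move/addrI ->; rewrite expr2.
(* As an average of nonnegative values this is nonnegative, with no bound on [a] to prove. *)
have ac0 x : 0 <= 1 + a * cos x by rewrite shift Rintegral_ge0.
apply: EFin_inj.
refine (etrans (EFin_Rintegral_normal_prob s bD c0)
  (etrans _ (esym (EFin_Rintegral_normal_prob r bD' ac0)))).
(* Here [z.1] is the sum and [z.2] one of its summands; the last two factors are their joint
   density. *)
pose K (z : Rm * Rm) : \bar R :=
  ((1 + cos z.1) * (normal_pdf 0 r (z.1 - z.2) * normal_pdf 0 r z.2))%:E.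
have K0 z : (0 <= K z)%E by rewrite lee_fin !mulr_ge0.
have mK : measurable_fun setT K.
  apply/measurable_EFinP; apply: measurable_funM.
    by apply: (measurableT_comp bD.1); exact: measurable_fst.
  apply: measurable_funM.
    apply: (measurableT_comp (mp 0 r)); exact: measurable_funB.
  by apply: (measurableT_comp (mp 0 r)); exact: measurable_snd.
(* Given the sum [u], the summand [x] is normal with mean [u / 2] and standard deviation [s / 2].
   This conditional density integrates to 1 and leaves the density of the sum. *)
transitivity (\int[mu]_u \int[mu]_x K (u, x))%E.
  apply: eq_integral => u _.
  under eq_integral do rewrite /K /= (normal_pdf_mul_shift _ _ r0 s0 sr) mulrA EFinM.
  rewrite ge0_integralZl//; last 3 first.
  - by apply/measurable_EFinP; exact: mp.
  - by move=> x _; rewrite lee_fin; exact: p0.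
  - by rewrite lee_fin; exact: mulr_ge0 (c0 u) (p0 _ _ u).
  by rewrite integral_normal_pdf mule1.
refine (etrans (fubini_tonelli (m1 := mu) (m2 := mu) K mK K0) _).
apply: eq_integral => x _.
have shx0 y : 0 <= 1 + cos (x + y) by exact: c0.
rewrite /= EFinM shift (EFin_Rintegral_normal_prob _ (bsh x) shx0).
rewrite -ge0_integralZr//; last 3 first.
- by apply/measurable_EFinP; apply: measurable_funM; [exact: (bsh x).1|exact: mp].
- by move=> y _; rewrite lee_fin; exact: mulr_ge0 (shx0 y) (p0 _ _ y).
- by rewrite lee_fin; exact: p0.
pose G u := (1 + cos u) * normal_pdf 0 r (u - x) * normal_pdf 0 r x.
transitivity (\int[mu]_u (G u)%:E)%E.
  by apply: eq_integral => u _; rewrite /K /G /= mulrA.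
(* Substituting [u = y + x] passes from the sum to the other summand [y]. *)
rewrite (@ge0_integralT_shift _ x G).
- apply: eq_integral => y _; rewrite -EFinM; congr (_%:E).
  by rewrite /G addrK [y + x]addrC.
- move=> u; apply: cvgM; last exact: cvg_cst.
  apply: cvgM; first exact: cc.
  apply: (@continuous_comp _ _ _ (fun u => u - x)).
    by apply: cvgB; [exact: cvg_id|exact: cvg_cst].
  by apply: continuous_normal_pdf; rewrite gt_eqF.
- by move=> u; exact: mulr_ge0 (mulr_ge0 (c0 u) (p0 _ _ _)) (p0 _ _ _).
Qed.

(** Two summands of standard deviation [s / Num.sqrt 2] have total variance [s ^+ 2], so the moment
    is a square. *)
Lemma normal_cos_moment_ge0 (s : R) : 0 < s ->
  0 <= \int[normal_prob 0 s]_t cos t.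
Proof.
move=> s0; rewrite (@normal_cos_moment_sqr (s / Num.sqrt 2)) ?sqr_ge0//.
  by rewrite divr_gt0// sqrtr_gt0.
by rewrite expr_div_n sqr_sqrtr// -mulr_natr divfK.
Qed.

End normal_trigonometric_moments.

(** * From normal to wrapped normal laws *)

Section wrapping.
Context (R : realType).

Lemma measurable_wrap2pi : measurable_fun setT (@wrap2pi R).
Proof.
apply: measurable_funB => //; apply: measurable_funM => //.
apply: nondecreasing_measurable => // x y xy.
rewrite ler_int; apply: le_floor; rewrite ler_pM2r// invr_gt0 mulr_gt0//.
exact: pi_gt0.
Qed.

Lemma periodic_wrap2pi (f : R -> R) (y : R) :
  periodic f (pi *+ 2) -> f (wrap2pi y) = f y.
Proof.
move=> pf; rewrite /wrap2pi; set k := Num.floor _.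
have -> : 2 * pi = pi *+ 2 :> R by rewrite mulr_natl.
have kE n : pi *+ 2 * n%:Z%:~R = pi *+ 2 *+ n :> R by rewrite -pmulrn mulr_natr.
(* Periodicity iterates over natural numbers: for positive [k] it is applied at the wrapped point,
   for negative [k] at [y]. *)
case: (intP k) => [|n|n].
- by rewrite mulr0 subr0.
- by rewrite kE -[LHS](periodicn pf n.+1) subrK.
- by rewrite mulrNz mulrN opprK kE periodicn.
Qed.

(** After a shift to nonnegative integrands, the common law is integrated once as the distribution
    of [X] and once as the image of [L] under [w]. Below, [w] is [wrap2pi] and [L] the unwrapped
    law. *)
Lemma Rintegral_same_law d d' (T : measurableType d) (U : measurableType d')
    (P : probability T R) (L : probability U R) (X : T -> R) (w : U -> R)
    (f : R -> R) :
  measurable_fun setT X -> measurable_fun setT w ->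
  (forall A, measurable A -> P (X @^-1` A) = L (w @^-1` A)) ->
  bounded_measurable f ->
  \int[P]_t f (X t) = \int[L]_y f (w y).
Proof.
move=> mX mw XL bf.
have [M [M0 fM]] := bounded_measurable_shift_ge0 bf.
have bfM := bounded_measurableD bf (bounded_measurable_cst R M).
suff : \int[P]_t (f (X t) + M) = \int[L]_y (f (w y) + M).
  rewrite !bounded_RintegralD ?prob_Rintegral_cst; [lra|..];
    by [exact: bounded_measurable_comp|exact: bounded_measurable_cst].
apply: EFin_inj; rewrite !EFin_Rintegral; last 2 first.
- exact: (bounded_measurable_comp mw bfM).
- exact: (bounded_measurable_comp mX bfM).
pose X' : {mfun T >-> R} := HB.pack X (isMeasurableFun.Build _ _ _ _ _ mX).
transitivity (\int[distribution P X']_y (f y + M)%:E)%E.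
  by rewrite ge0_integral_distribution//; apply/measurable_EFinP; exact: bfM.1.
rewrite (@ge0_integral_image_density _ _ _ _ _ L _ w (cst 1))//; last 2 first.
- move=> A mA; apply: etrans (XL A mA) (esym _).
  have mwA : measurable (w @^-1` A) by rewrite -[X in measurable X]setTI; exact: mw.
  exact: etrans (integral_cst L mwA 1%E) (mul1e _).
- exact: bfM.1.
by apply: eq_integral => y _; rewrite mulr1.
Qed.

Section moments.
Context d (T : measurableType d) (P : probability T R) (X : T -> R) (g : R).
Hypotheses (mX : measurable_fun setT X) (g_ge0 : 0 <= g).
Hypothesis lawX : has_wrapped_normal_law P X g.

(** A function of period [pi *+ 2] does not see the wrapping, so its mean is taken under the
    unwrapped law, which is the point mass at 0 when [g] is 0. *)
Let Rintegral_wrapped (f : R -> R) :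
  bounded_measurable f -> periodic f (pi *+ 2) ->
  \int[P]_t f (X t) =
    if g == 0 then f 0 else \int[normal_prob 0 (Num.sqrt g)]_y f y.
Proof.
move=> bf pf; have mw := measurable_wrap2pi.
have fw y : f (wrap2pi y) = f y by exact: periodic_wrap2pi.
have := lawX; rewrite /has_wrapped_normal_law /gauss_law; case: ifPn => _ XL.
  rewrite (Rintegral_same_law (L := \d_(0 : R)) mX mw XL bf).
  under eq_Rintegral do rewrite fw.
  rewrite /Rintegral integral_dirac//; last by apply/measurable_EFinP; exact: bf.1.
  by rewrite diracT mul1e.
rewrite (Rintegral_same_law
  (L := normal_prob 0 (Num.sqrt g) : probability (measurableTypeR R) R) mX mw XL bf).
by under eq_Rintegral do rewrite fw.
Qed.

Lemma wrapped_normal_sin_moment : \int[P]_t sin (X t) = 0.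
Proof.
rewrite Rintegral_wrapped; last 2 first.
- exact: bounded_measurable_sin.
- exact: sinD2pi.
case: eqP => [_|/eqP g0]; first exact: sin0.
by apply: normal_sin_moment; rewrite sqrtr_gt0 lt_neqAle eq_sym g0.
Qed.

Lemma wrapped_normal_cos_moment_ge0 : 0 <= \int[P]_t cos (X t).
Proof.
rewrite Rintegral_wrapped; last 2 first.
- exact: bounded_measurable_cos.
- exact: cosD2pi.
case: eqP => [_|/eqP g0]; first by rewrite cos0.
by apply: normal_cos_moment_ge0; rewrite sqrtr_gt0 lt_neqAle eq_sym g0.
Qed.

End moments.
End wrapping.

(** * Supermodularity *)

(* Each term [w x] is collected exactly when all of [U x] is present, so its
   increment when adding [e] can only switch on as the set grows. *)
Lemma supermodular_sum_subset (R : realType) (N : nat) (I : finType)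
    (U : I -> {set 'I_N}) (w : I -> R) : (forall x, 0 <= w x) ->
  supermodular (fun S => (\sum_(x | U x \subset S) w x)%:E).
Proof.
move=> w0 X Y e XY eY; rewrite -!EFinN -!EFinD lee_fin !opprK.
rewrite [leLHS]addrC [leRHS]addrC -[leLHS]opprB -[leRHS]opprB lerN2.
pose F (S : {set 'I_N}) := \sum_x w x * (U x \subset S)%:R.
have FE (S : {set 'I_N}) : \sum_(x | U x \subset S) w x = F S.
  rewrite big_mkcond /=; apply: eq_bigr => x _.
  by case: (_ \subset _); rewrite ?mulr1 ?mulr0.
rewrite !FE /F -!sumrB; apply: ler_sum => x _; rewrite -!mulrBr ler_wpM2l//.
have XeX : U x \subset X -> U x \subset e |: X.
  by move=> h; apply: (fintype.subset_trans h); exact: finset.subsetUr.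
have eXeY : U x \subset e |: X -> U x \subset e |: Y.
  by move=> h; apply: (fintype.subset_trans h); exact: finset.setUS.
have YeY : U x \subset Y -> U x \subset e |: Y.
  by move=> h; apply: (fintype.subset_trans h); exact: finset.subsetUr.
(* Here [e \notin Y] enters: a term already collected in [Y] has increment 0 there, and must then
   have increment 0 at [X] too. *)
have YX : U x \subset Y -> U x \subset e |: X -> U x \subset X.
  move=> hY /fintype.subsetP heX; apply/fintype.subsetP => y yU.
  have := heX y yU; rewrite in_setU1 => /predU1P[ye|//].
  by have := fintype.subsetP hY y yU; rewrite ye (negbTE eY).
move: XeX eXeY YeY YX.
case: (U x \subset X); case: (U x \subset e |: X); case: (U x \subset Y);
  case: (U x \subset e |: Y) => XeX eXeY YeY YX;
  first [by have := XeX isT | by have := eXeY isT | by have := YeY isT |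
    by have := YX isT isT | by rewrite ?subrr ?subr0 ?ler01].
Qed.

Section nonneg_variance.
Context d (T : measurableType d) (R : realType) (P : probability T R).

(** Expand the mean of the nonnegative function [(f t - a) ^+ 2], where [a] is the mean of [f]. *)
Lemma sqr_Rintegral_le (f : T -> R) : bounded_measurable f ->
  (\int[P]_t f t) ^+ 2 <= \int[P]_t (f t * f t).
Proof.
move=> bf; set a := \int[P]_t f t.
have bff := bounded_measurableM bf bf.
have baf := bounded_measurableM (bounded_measurable_cst T (2 * a)) bf.
have bB := bounded_measurableB bff baf.
have ba := bounded_measurable_cst T (a * a).
have : 0 <= \int[P]_t (f t * f t - 2 * a * f t + a * a).
  by apply: Rintegral_ge0 => t _; have := sqr_ge0 (f t - a); rewrite expr2; nra.
rewrite bounded_RintegralD// bounded_RintegralB// bounded_RintegralZl//.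
by rewrite prob_Rintegral_cst -/a expr2; lra.
Qed.

Lemma EFin_variance (f : T -> R) : bounded_measurable f ->
  'V_P[f]%E = (\int[P]_t (f t * f t) - (\int[P]_t f t) ^+ 2)%:E.
Proof.
move=> bf; have bff := bounded_measurableM bf bf.
rewrite /variance covarianceE; last 3 first.
- exact/Lfun1_integrable/bounded_measurable_integrable.
- exact/Lfun1_integrable/bounded_measurable_integrable.
- exact/Lfun1_integrable/bounded_measurable_integrable.
by rewrite unlock EFinB expr2 EFinM !EFin_Rintegral.
Qed.

End nonneg_variance.

(** * Means and covariances of the pairwise cosines *)

Section beam_gain_moments.
Context (R : realType) (N : nat) (gamma : 'I_N -> R).
Context (d : measure_display) (T : measurableType d) (P : probability T R).
Context (Phi : 'I_N -> T -> R).
Hypothesis gamma_ge0 : forall i, 0 <= gamma i.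
Hypothesis mPhi : forall i, measurable_fun setT (Phi i).
Hypothesis indPhi : mutually_independent P Phi.
Hypothesis lawPhi : forall i, has_wrapped_normal_law P (Phi i) (gamma i).
Local Notation E f := (\int[P]_t f t)%R.
Let c i j t := cos (Phi i t - Phi j t).
Let a i := E (fun t => cos (Phi i t)).

Let Esin i : E (fun t => sin (Phi i t)) = 0.
Proof. exact: wrapped_normal_sin_moment (mPhi i) (gamma_ge0 i) (lawPhi i). Qed.

Let a_ge0 i : 0 <= a i.
Proof. exact: wrapped_normal_cos_moment_ge0 (mPhi i) (gamma_ge0 i) (lawPhi i). Qed.

Let bcos : @bounded_measurable _ R R cos. Proof. exact: bounded_measurable_cos. Qed.
Let bsin : @bounded_measurable _ R R sin. Proof. exact: bounded_measurable_sin. Qed.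
Let bcosP i := bounded_measurable_comp (mPhi i) bcos.
Let bsinP i := bounded_measurable_comp (mPhi i) bsin.

Let bc i j : bounded_measurable (c i j).
Proof.
by apply: (bounded_measurable_comp _ bcos); exact: measurable_funB.
Qed.

Let bcc i j k l : bounded_measurable (fun t => c i j t * c k l t).
Proof. exact: bounded_measurableM. Qed.

Let c_sym i j : c i j = c j i.
Proof. by apply/funext => t; rewrite /c -cosN opprB. Qed.

Let c_diag i : c i i = (fun=> 1).
Proof. by apply/funext => t; rewrite /c subrr cos0. Qed.

Let E_c i j : i != j -> E (c i j) = a i * a j.
Proof.
move=> ij.
transitivity (E (fun t => cos (Phi i t) * cos (Phi j t) +
    sin (Phi i t) * sin (Phi j t))).
  by apply: eq_Rintegral => t _; rewrite /c cosB.
rewrite (bounded_RintegralD _ (bounded_measurableM (bcosP i) (bcosP j))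
  (bounded_measurableM (bsinP i) (bsinP j))).
by rewrite !(Rintegral_mul2_independent mPhi indPhi)// !Esin mul0r addr0.
Qed.

Let E_c_ge0 i j : 0 <= E (c i j).
Proof.
have [->|ij] := eqVneq i j; first by rewrite c_diag prob_Rintegral_cst.
by rewrite E_c// mulr_ge0.
Qed.

Let E_sum4 (f1 f2 f3 f4 : T -> R) :
  bounded_measurable f1 -> bounded_measurable f2 ->
  bounded_measurable f3 -> bounded_measurable f4 ->
  E (fun t => f1 t + f2 t + f3 t + f4 t) = E f1 + E f2 + E f3 + E f4.
Proof.
move=> b1 b2 b3 b4; have b12 := bounded_measurableD b1 b2.
have b123 := bounded_measurableD b12 b3.
by rewrite (bounded_RintegralD _ b123 b4) (bounded_RintegralD _ b12 b3)
  (bounded_RintegralD _ b1 b2).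
Qed.

(* Conditionally on [Phi i], [c i j] and [c i l] are independent with means
   [a j * cos (Phi i)] and [a l * cos (Phi i)]. *)
Let cov_shared i j l : i != j -> i != l ->
  E (c i j) * E (c i l) <= E (fun t => c i j t * c i l t).
Proof.
move=> ij il; have [<-|jl] := eqVneq j l.
  by rewrite -expr2; exact: sqr_Rintegral_le.
have u : uniq [:: i; j; l] by rewrite /= !inE (negbTE ij) (negbTE il) (negbTE jl).
pose C2 x : R := cos x * cos x; pose S2 x : R := sin x * sin x.
pose CS x : R := cos x * sin x.
have bC2 : @bounded_measurable _ R R C2 by exact: bounded_measurableM.
have bS2 : @bounded_measurable _ R R S2 by exact: bounded_measurableM.
have bCS : @bounded_measurable _ R R CS by exact: bounded_measurableM.
have b3 (f g h : R -> R) : bounded_measurable f -> bounded_measurable g ->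
    bounded_measurable h ->
    bounded_measurable (fun t => f (Phi i t) * g (Phi j t) * h (Phi l t)).
  move=> bf bg bh.
  by do ![apply: bounded_measurableM]; exact: bounded_measurable_comp.
have -> : E (fun t => c i j t * c i l t) = E (fun t => C2 (Phi i t)) * a j * a l.
  (* Every term but the first carries a sine of [Phi j] or [Phi l] as an independent factor of mean
     0. *)
  transitivity (E (fun t =>
      C2 (Phi i t) * cos (Phi j t) * cos (Phi l t)
    + CS (Phi i t) * cos (Phi j t) * sin (Phi l t)
    + CS (Phi i t) * sin (Phi j t) * cos (Phi l t)
    + S2 (Phi i t) * sin (Phi j t) * sin (Phi l t))).
    by apply: eq_Rintegral => t _; rewrite /c !cosB /C2 /CS /S2; ring.
  rewrite E_sum4; [|exact: b3..].
  rewrite !(Rintegral_mul3_independent mPhi indPhi u)// !Esin /a.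
  by rewrite !(mulr0, mul0r, addr0).
(* With [a j * a l] factored out on both sides, what remains is that [cos (Phi i)] has nonnegative
   variance. *)
rewrite !E_c// mulrACA -mulrA mulrA -[leRHS]mulrA -expr2.
apply: ler_wpM2r; first by rewrite mulr_ge0.
exact: sqr_Rintegral_le.
Qed.

(** Expanding both cosines and factoring over four independent phases, only the term without sines
    survives, and it is the product of the four [a]. *)
Let cov_disjoint i j k l : uniq [:: i; j; k; l] ->
  E (fun t => c i j t * c k l t) = E (c i j) * E (c k l).
Proof.
move=> u.
have b4 (f g h e : R -> R) : bounded_measurable f -> bounded_measurable g ->
    bounded_measurable h -> bounded_measurable e ->
    bounded_measurable
      (fun t => f (Phi i t) * g (Phi j t) * h (Phi k t) * e (Phi l t)).
  move=> bf bg bh be.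
  by do ![apply: bounded_measurableM]; exact: bounded_measurable_comp.
transitivity (E (fun t =>
    cos (Phi i t) * cos (Phi j t) * cos (Phi k t) * cos (Phi l t)
  + cos (Phi i t) * cos (Phi j t) * sin (Phi k t) * sin (Phi l t)
  + sin (Phi i t) * sin (Phi j t) * cos (Phi k t) * cos (Phi l t)
  + sin (Phi i t) * sin (Phi j t) * sin (Phi k t) * sin (Phi l t))).
  by apply: eq_Rintegral => t _; rewrite /c !cosB; ring.
rewrite E_sum4; [|exact: b4..].
rewrite !(Rintegral_mul4_independent mPhi indPhi u)// !Esin.
have := u; rewrite /= !inE !negb_or andbT => /and3P[/and3P[ij _ _] _ kl].
by rewrite !E_c// /a !(mulr0, mul0r, addr0) !mulrA.
Qed.

(** If a pair is diagonal, its cosine is the constant 1 and the covariance is 0. Otherwise the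
    symmetry of [c] moves a shared index to the front for [cov_shared], which also covers equal
    pairs; with no shared index [cov_disjoint] gives equality. *)
Let cov_ge0 i j k l : E (c i j) * E (c k l) <= E (fun t => c i j t * c k l t).
Proof.
have [->|ij] := eqVneq i j.
  rewrite c_diag prob_Rintegral_cst mul1r.
  by under [leRHS]eq_Rintegral do rewrite mul1r.
have [->|kl] := eqVneq k l.
  rewrite c_diag prob_Rintegral_cst mulr1.
  by under [leRHS]eq_Rintegral do rewrite mulr1.
have [ik|ik] := eqVneq i k; first by rewrite -ik; apply: cov_shared; rewrite // ik.
have [il|il] := eqVneq i l.
  by rewrite [c k l]c_sym -il; apply: cov_shared; rewrite // eq_sym.
have [jk|jk] := eqVneq j k.
  by rewrite [c i j]c_sym -jk; apply: cov_shared; rewrite ?jk // eq_sym -?jk.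
have [jl|jl] := eqVneq j l.
  rewrite [c i j]c_sym [c k l]c_sym -jl.
  by apply: cov_shared; rewrite // eq_sym.
by rewrite cov_disjoint//= !inE !negb_or ij ik il jk jl kl.
Qed.

Let gainE S t : beam_gain Phi S t =
  \sum_(p : 'I_N * 'I_N | (p.1 \in S) && (p.2 \in S)) c p.1 p.2 t.
Proof. by rewrite /beam_gain pair_big. Qed.

Let bgain S : bounded_measurable (beam_gain Phi S).
Proof.
rewrite (_ : beam_gain Phi S = fun t => beam_gain Phi S t)//.
under eq_fun do rewrite gainE.
by apply: bounded_measurable_sum => p; exact: bc.
Qed.

Let E_gain S : E (beam_gain Phi S) =
  \sum_(p : 'I_N * 'I_N | (p.1 \in S) && (p.2 \in S)) E (c p.1 p.2).
Proof.
under eq_Rintegral do rewrite gainE.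
by rewrite bounded_Rintegral_sum.
Qed.

Lemma supermodular_expectation_beam_gain :
  supermodular (fun S => 'E_P[beam_gain Phi S]%E).
Proof.
suff -> : (fun S => 'E_P[beam_gain Phi S]%E) =
    (fun S => (\sum_(p : 'I_N * 'I_N | [set p.1; p.2]%SET \subset S)
      E (c p.1 p.2))%:E).
  exact: supermodular_sum_subset.
apply/funext => S; rewrite unlock -EFin_Rintegral// E_gain; congr _%:E.
by apply: eq_bigl => p; rewrite finset.subUset !finset.sub1set.
Qed.

Lemma supermodular_variance_beam_gain :
  supermodular (fun S => 'V_P[beam_gain Phi S]%E).
Proof.
(* The covariance of two pairwise cosines, nonnegative by [cov_ge0]. *)
pose w (q : ('I_N * 'I_N) * ('I_N * 'I_N)) :=
  E (fun t => c q.1.1 q.1.2 t * c q.2.1 q.2.2 t) -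
  E (c q.1.1 q.1.2) * E (c q.2.1 q.2.2).
suff -> : (fun S => 'V_P[beam_gain Phi S]%E) =
    (fun S => (\sum_(q : ('I_N * 'I_N) * ('I_N * 'I_N) |
      [set q.1.1; q.1.2; q.2.1; q.2.2]%SET \subset S) w q)%:E).
  by apply: supermodular_sum_subset => q; rewrite subr_ge0.
apply/funext => S; rewrite EFin_variance//; congr _%:E.
(* The squared mean and the mean of the square both become sums over pairs of pairs in [S], and are
   subtracted term by term. *)
rewrite E_gain expr2 big_distrlr /=.
under eq_Rintegral do rewrite !gainE big_distrlr /= pair_big /=.
rewrite bounded_Rintegral_sum; last by move=> q; exact: bcc.
rewrite pair_big /= -sumrB; apply: eq_bigl => q.
by rewrite !finset.subUset !finset.sub1set -!andbA.
Qed.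

End beam_gain_moments.

Unset Implicit Arguments.

Theorem theorem2 (R : realType) (N : nat) (gamma : 'I_N -> R)
    (d : measure_display) (T : measurableType d) (P : probability T R)
    (Phi : 'I_N -> T -> R) :
  (forall i, 0 <= gamma i) ->
  (forall i, measurable_fun setT (Phi i)) ->
  mutually_independent P Phi ->
  (forall i, has_wrapped_normal_law P (Phi i) (gamma i)) ->
  supermodular (fun S => 'E_P[beam_gain Phi S]%E) /\
  supermodular (fun S => 'V_P[beam_gain Phi S]%E).
Proof.
move=> gamma_ge0 mPhi indPhi lawPhi; split.
- exact: supermodular_expectation_beam_gain gamma_ge0 mPhi indPhi lawPhi.
- exact: supermodular_variance_beam_gain gamma_ge0 mPhi indPhi lawPhi.
Qed.
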